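(* The derivability problem for the multiplicative fragment $\mathcal{M}^{\mathrm{mult}}_{2018}$ of Morrill's calculus with stoups defined below is algorithmically undecidable.
   Context: Formulae are built from a countable set of variables and the constant $\mathbf{1}$ by the binary connectives $\backslash$, $/$, $\cdot$ and the unary connectives $\langle\rangle$, $[]^{-1}$ and $!$. A stoup is a finite multiset of formulae ($\varnothing$ empty). A tree term is a formula or $[\Xi]$ with $\Xi$ a meta-formula; a meta-formula is $\zeta;\Gamma$ with $\zeta$ a stoup and $\Gamma$ a finite linearly ordered sequence of tree terms (empty sequence $\Lambda$); $\varnothing;\Gamma$ is written $\Gamma$. Comma denotes concatenation of sequences and multiset union of stoups; $\zeta,A$ adds a copy of $A$. A sequent is $\Xi\to C$. $\Xi(\Theta)$ denotes a meta-formula with a designated occurrence of a meta-formula $\Theta$ which is $\Xi$ itself or the content of some bracket $[\Theta]$ at any depth; $\Xi(\Theta')$ is the result of replacement. The calculus $\mathcal{M}^{\mathrm{mult}}_{2018}$ has: axioms $A\to A$, $\Lambda\to\mathbf1$; ($/L$) from $\zeta_1;\Gamma\to B$ and $\Xi(\zeta_2;\Delta_1,C,\Delta_2)\to D$ infer $\Xi(\zeta_1,\zeta_2;\Delta_1,C/B,\Gamma,\Delta_2)\to D$; ($/R$) from $\zeta;\Gamma,B\to C$ infer $\zeta;\Gamma\to C/B$; ($\backslash L$) from $\zeta_1;\Gamma\to A$ and $\Xi(\zeta_2;\Delta_1,C,\Delta_2)\to D$ infer $\Xi(\zeta_1,\zeta_2;\Delta_1,\Gamma,A\backslash C,\Delta_2)\to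 D$; ($\backslash R$) from $\zeta;A,\Gamma\to C$ infer $\zeta;\Gamma\to A\backslash C$; ($\cdot L$) from $\Xi(\zeta;\Delta_1,A,B,\Delta_2)\to D$ infer $\Xi(\zeta;\Delta_1,A\cdot B,\Delta_2)\to D$; ($\cdot R$) from $\zeta_1;\Delta\to A$ and $\zeta_2;\Gamma\to B$ infer $\zeta_1,\zeta_2;\Delta,\Gamma\to A\cdot B$; ($\mathbf1L$) from $\Xi(\zeta;\Delta_1,\Delta_2)\to A$ infer $\Xi(\zeta;\Delta_1,\mathbf1,\Delta_2)\to A$; ($[]^{-1}L$) from $\Xi(\zeta;\Delta_1,A,\Delta_2)\to B$ infer $\Xi(\zeta;\Delta_1,[[]^{-1}A],\Delta_2)\to B$; ($[]^{-1}R$) from $[\Xi]\to A$ infer $\Xi\to[]^{-1}A$; ($\langle\rangle L$) from $\Xi(\zeta;\Delta_1,[A],\Delta_2)\to B$ infer $\Xi(\zeta;\Delta_1,\langle\rangle A,\Delta_2)\to B$; ($\langle\rangle R$) from $\Xi\to A$ infer $[\Xi]\to\langle\rangle A$; ($!L$) from $\Xi(\zeta,A;\Gamma_1,\Gamma_2)\to B$ infer $\Xi(\zeta;\Gamma_1,!A,\Gamma_2)\to B$; ($!P$) from $\Xi(\zeta;\Gamma_1,A,\Gamma_2)\to B$ infer $\Xi(\zeta,A;\Gamma_1,\Gamma_2)\to B$; ($!R$) from $!A\to B$ infer $!A\to!B$; ($!C$) from $\Xi(\zeta,A;\Gamma_1,[A;\Gamma_2],\Gamma_3)\to B$ infer $\Xi(\zeta,A;\Gamma_1,[[\Gamma_2]],\Gamma_3)\to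 B$. Here $A,B,C,D$ are formulae, $\Gamma,\Delta,\Delta_i,\Gamma_i$ sequences of tree terms, $\zeta,\zeta_i$ stoups. Cut is not a rule. *)

(* Defs.v *)
From Stdlib Require Import List Permutation Arith.
Import ListNotations.

Inductive formula : Type :=
| Var   : nat -> formula
| One   : formula
| Under : formula -> formula -> formula   (* Under A C  =  A \ C *)
| Over  : formula -> formula -> formula   (* Over C B   =  C / B *)
| Prod  : formula -> formula -> formula
| Dia   : formula -> formula
| Binv  : formula -> formula
| Bang  : formula -> formula.

(** A stoup is a finite multiset of formulae, represented by a list
    (its order is irrelevant: every rule producing a stoup allows any
    permutation, see below).  A tree term is a formula or a bracket [Xi]
    of a meta-formula Xi = zeta;Gamma.  TB z G is the tree term [z;G]. *)
Inductive tree : Type :=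
| TF : formula -> tree
| TB : list formula -> list tree -> tree.

Definition stoup := list formula.
Definition meta := (stoup * list tree)%type.

(** Contexts Xi(-): a designated meta-formula occurrence, either the whole
    meta-formula (Hole) or the content of a bracket at any depth. *)
Inductive ctx : Type :=
| Hole : ctx
| Deep : stoup -> list tree -> ctx -> list tree -> ctx.

Fixpoint plug (c : ctx) (m : meta) : meta :=
  match c with
  | Hole => m
  | Deep z l c' r => (z, l ++ TB (fst (plug c' m)) (snd (plug c' m)) :: r)
  end.

Inductive der : meta -> formula -> Prop :=
| r_ax : forall A, der ([], [TF A]) A
| r_one : der ([], []) One
| r_overL : forall X z z1 z2 G D1 D2 B C D,
    der (z1, G) B ->
    der (plug X (z2, D1 ++ TF C :: D2)) D ->
    Permutation z (z1 ++ z2) ->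
    der (plug X (z, D1 ++ TF (Over C B) :: G ++ D2)) D
| r_overR : forall z G B C,
    der (z, G ++ [TF B]) C -> der (z, G) (Over C B)
| r_underL : forall X z z1 z2 G D1 D2 A C D,
    der (z1, G) A ->
    der (plug X (z2, D1 ++ TF C :: D2)) D ->
    Permutation z (z1 ++ z2) ->
    der (plug X (z, D1 ++ G ++ TF (Under A C) :: D2)) D
| r_underR : forall z G A C,
    der (z, TF A :: G) C -> der (z, G) (Under A C)
| r_prodL : forall X z D1 D2 A B D,
    der (plug X (z, D1 ++ TF A :: TF B :: D2)) D ->
    der (plug X (z, D1 ++ TF (Prod A B) :: D2)) D
| r_prodR : forall z z1 z2 D G A B,
    der (z1, D) A -> der (z2, G) B ->
    Permutation z (z1 ++ z2) ->
    der (z, D ++ G) (Prod A B)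
| r_oneL : forall X z D1 D2 A,
    der (plug X (z, D1 ++ D2)) A ->
    der (plug X (z, D1 ++ TF One :: D2)) A
| r_binvL : forall X z D1 D2 A B,
    der (plug X (z, D1 ++ TF A :: D2)) B ->
    der (plug X (z, D1 ++ TB [] [TF (Binv A)] :: D2)) B
| r_binvR : forall z G A,
    der ([], [TB z G]) A -> der (z, G) (Binv A)
| r_diaL : forall X z D1 D2 A B,
    der (plug X (z, D1 ++ TB [] [TF A] :: D2)) B ->
    der (plug X (z, D1 ++ TF (Dia A) :: D2)) B
| r_diaR : forall z G A,
    der (z, G) A -> der ([], [TB z G]) (Dia A)
| r_bangL : forall X z z' G1 G2 A B,
    Permutation z' (A :: z) ->
    der (plug X (z', G1 ++ G2)) B ->
    der (plug X (z, G1 ++ TF (Bang A) :: G2)) B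
| r_bangP : forall X z z' G1 G2 A B,
    Permutation z' (A :: z) ->
    der (plug X (z, G1 ++ TF A :: G2)) B ->
    der (plug X (z', G1 ++ G2)) B
| r_bangR : forall A B,
    der ([], [TF (Bang A)]) B -> der ([], [TF (Bang A)]) (Bang B)
| r_bangC : forall X z z' G1 G2 G3 A B,
    Permutation z' (A :: z) ->
    der (plug X (z', G1 ++ TB [A] G2 :: G3)) B ->
    der (plug X (z', G1 ++ TB [] [TB [] G2] :: G3)) B.

(** Bijection nat*nat -> nat. *)
Definition npair (a b : nat) : nat := 2 ^ a * (2 * b + 1) - 1.

Fixpoint enc_formula (A : formula) : nat :=
  match A with
  | Var n => npair 0 n
  | One => npair 1 0
  | Under A C => npair 2 (npair (enc_formula A) (enc_formula C))
  | Over C B => npair 3 (npair (enc_formula C) (enc_formula B))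
  | Prod A B => npair 4 (npair (enc_formula A) (enc_formula B))
  | Dia A => npair 5 (enc_formula A)
  | Binv A => npair 6 (enc_formula A)
  | Bang A => npair 7 (enc_formula A)
  end.

Fixpoint enc_list {T : Type} (e : T -> nat) (l : list T) : nat :=
  match l with
  | [] => 0
  | x :: l => S (npair (e x) (enc_list e l))
  end.

Fixpoint enc_tree (t : tree) : nat :=
  match t with
  | TF A => npair 0 (enc_formula A)
  | TB z G =>
      npair 1 (npair (enc_list enc_formula z)
                 ((fix encs (l : list tree) : nat :=
                     match l with
                     | [] => 0
                     | t :: l => S (npair (enc_tree t) (encs l))
                     end) G))
  end.

Definition enc_meta (m : meta) : nat :=
  npair (enc_list enc_formula (fst m)) (enc_list enc_tree (snd m)).

Definition enc_sequent (m : meta) (C : formula) : nat :=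
  npair (enc_meta m) (enc_formula C).

Definition DerivProblem (n : nat) : Prop :=
  exists (m : meta) (C : formula), enc_sequent m C = n /\ der m C.

Inductive recf : Type :=
| RZero : recf
| RSucc : recf
| RProj : nat -> recf
| RComp : recf -> list recf -> recf
| RPrec : recf -> recf -> recf
| RMu   : recf -> recf.

Inductive ev : recf -> list nat -> nat -> Prop :=
| ev_zero : forall xs, ev RZero xs 0
| ev_succ : forall x xs, ev RSucc (x :: xs) (S x)
| ev_proj : forall i xs, ev (RProj i) xs (nth i xs 0)
| ev_comp : forall f gs xs ys y,
    evs gs xs ys -> ev f ys y -> ev (RComp f gs) xs y
| ev_prec0 : forall f g xs y,
    ev f xs y -> ev (RPrec f g) (0 :: xs) y
| ev_precS : forall f g n xs y z,
    ev (RPrec f g) (n :: xs) y -> ev g (n :: y :: xs) z ->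
    ev (RPrec f g) (S n :: xs) z
| ev_mu : forall f xs n,
    ev f (n :: xs) 0 ->
    (forall m, m < n -> exists k, ev f (m :: xs) (S k)) ->
    ev (RMu f) xs n
with evs : list recf -> list nat -> list nat -> Prop :=
| evs_nil : forall xs, evs [] xs []
| evs_cons : forall g gs xs y ys,
    ev g xs y -> evs gs xs ys -> evs (g :: gs) xs (y :: ys).

Definition decidable_set (P : nat -> Prop) : Prop :=
  exists f : recf, forall n, (P n -> ev f [n] 1) /\ (~ P n -> ev f [n] 0).

(* Main.v *)
(** A string rewriting system is simulated inside the calculus.  The formula
    [ticket], i.e. <><>1, turns (reading rules upwards) into the empty double
    bracket, which the contraction rule turns into [A; ] for any A in the stoup;
    if A = !([]^-1 B), the bracket can be removed and leaves B.  So a ticket can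
    be replaced by any stoup instance B: u\v performs the rewriting u -> v,
    x\(ticket.x) moves the ticket, ticket.ticket duplicates it, 1 erases it, and
    what remains in the stoup is absorbed by formulae 1/!([]^-1 B).

    The simulation is faithful because the calculus is sound for up-sets of binary
    relations, with the brackets read as the identity and a stoup formula read as
    the assertion that it contains the identity relation: a symbol x denotes the
    relations above a given relation R_x, and a rule u -> v is valid as soon as
    R_v is included in R_u.

    Recursive functions are compiled to loop programs over registers.  The words
    are programs, Inc r being at once a command and a unit of the content of the
    register r, and they denote their input-output relations.  Given a decision
    procedure f, compile q |-> f(s(q)), where s(q) is the code of the sequent
    saying that a program whose encoding is q returns 0 on the input q; applied to
    its own encoding, this program refutes f. *)
Require Import Defs.
From Stdlib Require Import List Permutation Arith Lia FunctionalExtensionality Relations.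
Import ListNotations.

(** * A relational model *)

Section RelationalModel.

Variables (St : Type) (val : nat -> St -> St -> Prop).

Notation rel := (St -> St -> Prop).

Definition rincl (P Q : rel) : Prop := forall s t, P s t -> Q s t.
Definition rcomp (P Q : rel) : rel := fun s t => exists m, P s m /\ Q m t.

(** Formulae denote up-sets of relations under inclusion, and product and the two divisions are
    those induced by composition. [Bang A] denotes the same up-set as [One] when [A] is valid, and
    the empty one otherwise. *)
Fixpoint fI (A : formula) (R : rel) : Prop :=
  match A with
  | Var n => rincl (val n) R
  | One => rincl eq R
  | Under A C => forall P, fI A P -> fI C (rcomp P R)
  | Over C B => forall P, fI B P -> fI C (rcomp R P)
  | Prod A B => exists P Q, fI A P /\ fI B Q /\ rincl (rcomp P Q) R
  | Dia A => fI A R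
  | Binv A => fI A R
  | Bang A => rincl eq R /\ fI A eq
  end.

Definition valid (A : formula) : Prop := fI A eq.

Fixpoint tI (t : tree) (R : rel) : Prop :=
  match t with
  | TF A => fI A R
  | TB z G =>
      Forall valid z /\
      (fix seqI (G : list tree) (R : rel) : Prop :=
         match G with
         | [] => rincl eq R
         | t :: G => exists P Q, tI t P /\ seqI G Q /\ rincl (rcomp P Q) R
         end) G R
  end.

(** Top-level copy of the recursion nested in [tI]; the two are convertible, which is all that
    [tI_bracket] uses. *)
Fixpoint seqI (G : list tree) (R : rel) : Prop :=
  match G with
  | [] => rincl eq R
  | t :: G => exists P Q, tI t P /\ seqI G Q /\ rincl (rcomp P Q) R
  end.

Definition mI (m : meta) (R : rel) : Prop :=
  Forall valid (fst m) /\ seqI (snd m) R.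

Lemma tI_bracket z G R : tI (TB z G) R <-> mI (z, G) R.
Proof. reflexivity. Qed.

Lemma rincl_trans P Q R : rincl P Q -> rincl Q R -> rincl P R.
Proof. unfold rincl; auto. Qed.

Lemma rincl_comp P P' Q Q' :
  rincl P P' -> rincl Q Q' -> rincl (rcomp P Q) (rcomp P' Q').
Proof. intros H1 H2 s t (m & ? & ?); exists m; auto. Qed.

Lemma rcomp_eq_l P : rincl (rcomp eq P) P.
Proof. now intros s t (m & -> & ?). Qed.

Lemma rcomp_eq_l' P : rincl P (rcomp eq P).
Proof. intros s t ?; exists s; auto. Qed.

Lemma rcomp_eq_r P : rincl (rcomp P eq) P.
Proof. now intros s t (m & ? & <-). Qed.

Lemma rcomp_eq_r' P : rincl P (rcomp P eq).
Proof. intros s t ?; exists t; auto. Qed.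

Lemma rcomp_assoc P Q R :
  rincl (rcomp (rcomp P Q) R) (rcomp P (rcomp Q R)).
Proof. intros s t (m & (k & ? & ?) & ?); exists k; split; [|exists m]; auto. Qed.

Lemma rcomp_assoc' P Q R :
  rincl (rcomp P (rcomp Q R)) (rcomp (rcomp P Q) R).
Proof. intros s t (m & ? & (k & ? & ?)); exists k; split; [exists m|]; auto. Qed.

Lemma rincl_refl P : rincl P P.
Proof. unfold rincl; auto. Qed.

Lemma fI_up A : forall P R, rincl P R -> fI A P -> fI A R.
Proof.
  induction A; simpl; intros P R HPR; eauto using rincl_trans.
  - intros H Q HQ. eapply IHA2; [|exact (H Q HQ)]. auto using rincl_comp, rincl_refl.
  - intros H Q HQ. eapply IHA1; [|exact (H Q HQ)]. auto using rincl_comp, rincl_refl.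
  - intros (U & V & ? & ? & ?); exists U, V; eauto using rincl_trans.
  - intros [? ?]; eauto using rincl_trans.
Qed.

Lemma seqI_up G P R : rincl P R -> seqI G P -> seqI G R.
Proof.
  destruct G; simpl; eauto using rincl_trans.
  intros HPR (U & V & ? & ? & ?); exists U, V; eauto using rincl_trans.
Qed.

Lemma tI_up t P R : rincl P R -> tI t P -> tI t R.
Proof.
  destruct t as [A|z G]; [apply fI_up|].
  rewrite !tI_bracket. intros H [? ?]; split; eauto using seqI_up.
Qed.

Lemma seqI_app G1 G2 R :
  seqI (G1 ++ G2) R <->
  exists P Q, seqI G1 P /\ seqI G2 Q /\ rincl (rcomp P Q) R.
Proof.
  revert R; induction G1 as [|t G1 IH]; simpl; intros R; split.
  - intros H; exists eq, R. auto using rincl_refl, rcomp_eq_l.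
  - intros (P & Q & HP & HQ & H). eapply seqI_up; [|exact HQ].
    eapply rincl_trans; [apply rcomp_eq_l'|].
    eapply rincl_trans; [|exact H]. auto using rincl_comp, rincl_refl.
  - intros (P & Q & HP & HQ & H). apply IH in HQ as (U & V & HU & HV & HQ).
    exists (rcomp P U), V. repeat split; auto.
    + exists P, U; auto using rincl_refl.
    + eapply rincl_trans; [apply rcomp_assoc|].
      eapply rincl_trans; [|exact H]. auto using rincl_comp, rincl_refl.
  - intros (P & Q & (U & V & HU & HV & HP) & HQ & H).
    exists U, (rcomp V Q); repeat split; auto.
    + apply IH. exists V, Q; auto using rincl_refl.
    + eapply rincl_trans; [apply rcomp_assoc'|].
      eapply rincl_trans; [|exact H]. auto using rincl_comp, rincl_refl.
Qed.

Lemma seqI_single t R : seqI [t] R <-> tI t R.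
Proof.
  simpl; split.
  - intros (P & Q & HP & HQ & H). eapply tI_up; [|exact HP].
    eapply rincl_trans; [apply rcomp_eq_r'|].
    eapply rincl_trans; [|exact H]. auto using rincl_comp, rincl_refl.
  - intros H; exists R, eq. auto using rincl_refl, rcomp_eq_r.
Qed.

Lemma seqI_mid D1 M M' D2 R :
  (forall P, seqI M P -> seqI M' P) ->
  seqI (D1 ++ M ++ D2) R -> seqI (D1 ++ M' ++ D2) R.
Proof.
  intros H. rewrite !seqI_app. intros (P & Q & HP & HQ & HR).
  exists P, Q; repeat split; auto. rewrite seqI_app in HQ |- *.
  destruct HQ as (U & V & ? & ? & ?). exists U, V; auto.
Qed.

(** Brackets are read as the identity and the stoups along the path do not change, so a local
    implication passes through any context. Each left rule thereby reduces to its designated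
    place. *)
Lemma plug_mono X m m' :
  (forall R, mI m R -> mI m' R) ->
  forall R, mI (plug X m) R -> mI (plug X m') R.
Proof.
  intros H; induction X as [|z l X IH r]; simpl; [exact H|].
  intros R [Hz HR]; split; [exact Hz|]; simpl in *.
  apply (seqI_mid l [TB (fst (plug X m)) (snd (plug X m))]
           [TB (fst (plug X m')) (snd (plug X m'))] r R); auto.
  intros P. rewrite !seqI_single, !tI_bracket, <- !surjective_pairing. auto.
Qed.

Lemma seqI_pair G1 G2 P Q :
  seqI G1 P -> seqI G2 Q -> seqI (G1 ++ G2) (rcomp P Q).
Proof. intros; apply seqI_app; exists P, Q; auto using rincl_refl. Qed.

Lemma valid_perm z z1 z2 :
  Permutation z (z1 ++ z2) -> Forall valid z -> Forall valid z1 /\ Forall valid z2.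
Proof. intros HP Hz. apply Forall_app. exact (Permutation_Forall HP Hz). Qed.

Lemma valid_perm_cons z z' A :
  Permutation z' (A :: z) -> Forall valid z' <-> valid A /\ Forall valid z.
Proof.
  intros H. rewrite <- Forall_cons_iff.
  split; apply Permutation_Forall; auto using Permutation_sym.
Qed.

Ltac left_rule IH H :=
  apply IH; revert H; apply plug_mono; intros R' [Hz HR']; simpl in Hz, HR'.

Theorem soundness m C : der m C -> forall R, mI m R -> fI C R.
Proof.
  induction 1; intros R HR.
  - destruct HR as [_ HR]. now apply seqI_single in HR.
  - apply HR.
  - left_rule IHder2 HR. apply (valid_perm _ _ _ H1) in Hz as [Hz1 Hz2].
    split; [exact Hz2|].
    apply (seqI_mid D1 (TF (Over C B) :: G) [TF C] D2); [|exact HR'].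
    intros P (U & V & HU & HV & HP). apply seqI_single.
    apply (fI_up C _ _ HP). apply HU, IHder1. now split.
  - simpl. intros P HP. apply IHder. destruct HR as [Hz HR]; split; [exact Hz|].
    apply seqI_pair; [exact HR|]. now apply seqI_single.
  - left_rule IHder2 HR. apply (valid_perm _ _ _ H1) in Hz as [Hz1 Hz2].
    split; [exact Hz2|].
    apply (seqI_mid D1 (G ++ [TF (Under A C)]) [TF C] D2);
      [|now rewrite <- app_assoc].
    intros P HP. apply seqI_app in HP as (U & V & HU & HV & HP).
    apply seqI_single. apply seqI_single in HV.
    apply (fI_up C _ _ HP). apply HV, IHder1. now split.
  - simpl. intros P HP. apply IHder. destruct HR as [Hz HR]; split; [exact Hz|].
    exists P, R; auto using rincl_refl.
  - left_rule IHder HR. split; [exact Hz|].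
    apply (seqI_mid D1 [TF (Prod A B)] [TF A; TF B] D2); [|exact HR'].
    intros P HP. apply seqI_single in HP as (U & V & HU & HV & HP).
    exists U, V. rewrite seqI_single. auto.
  - destruct HR as [Hz HR]; simpl in *.
    apply (valid_perm _ _ _ H1) in Hz as [Hz1 Hz2].
    apply seqI_app in HR as (U & V & HU & HV & HR).
    exists U, V; repeat split; auto; [apply IHder1|apply IHder2]; now split.
  - left_rule IHder HR. split; [exact Hz|].
    apply (seqI_mid D1 [TF One] [] D2); [|exact HR'].
    intros P HP. now apply seqI_single in HP.
  - left_rule IHder HR. split; [exact Hz|].
    apply (seqI_mid D1 [TB [] [TF (Binv A)]] [TF A] D2); [|exact HR'].
    intros P. rewrite !seqI_single, tI_bracket. intros [_ HP].
    now apply seqI_single in HP.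
  - simpl. apply IHder. split; [constructor|]. apply seqI_single, tI_bracket, HR.
  - left_rule IHder HR. split; [exact Hz|].
    apply (seqI_mid D1 [TF (Dia A)] [TB [] [TF A]] D2); [|exact HR'].
    intros P. rewrite !seqI_single, tI_bracket. intros HP; split; [constructor|].
    now apply seqI_single.
  - simpl. apply IHder. destruct HR as [_ HR].
    now apply seqI_single, tI_bracket in HR.
  - left_rule IHder HR.
    assert (valid A /\ seqI (G1 ++ G2) R') as [HA HG].
    { apply seqI_app in HR' as (U & V & HU & (P & Q & [HP HA] & HQ & HV) & HR').
      split; [exact HA|]. apply seqI_app. exists U, Q; repeat split; auto.
      eapply rincl_trans; [|exact HR']. apply rincl_comp; [apply rincl_refl|].
      eapply rincl_trans; [apply rcomp_eq_l'|].
      eapply rincl_trans; [|exact HV]. auto using rincl_comp, rincl_refl. }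
    split; [|exact HG]. now apply (valid_perm_cons _ _ _ H).
  - left_rule IHder HR. apply (valid_perm_cons _ _ _ H) in Hz as [HA Hz].
    split; [exact Hz|].
    apply (seqI_mid G1 [] [TF A] G2); [|exact HR'].
    intros P HP. apply seqI_single. exact (fI_up A _ _ HP HA).
  (* The antecedent [Bang A] forces [A] to be valid, so the premise may be evaluated at equality,
     which makes [B] valid as well. *)
  - destruct HR as [_ HR]. apply seqI_single in HR as [HR HA].
    split; [exact HR|]. apply IHder. split; [constructor|].
    apply seqI_single. split; [apply rincl_refl|exact HA].
  (* A double bracket and a single one have the same content; the validity of the copied formula
     comes from the outer stoup, where it stays. *)
  - left_rule IHder HR. split; [exact Hz|].
    apply (seqI_mid G1 [TB [] [TB [] G2]] [TB [A] G2] G3); [|exact HR'].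
    intros P. rewrite !seqI_single, !tI_bracket. intros [_ HP].
    apply seqI_single, tI_bracket in HP as [_ HP]. split; [|exact HP].
    apply (valid_perm_cons _ _ _ H) in Hz as [HA _]. now repeat constructor.
Qed.

End RelationalModel.

(** * Simulation of string rewriting *)

Definition word (w : list nat) : list tree := map (fun n => TF (Var n)) w.

Definition prodw (w : list nat) : formula :=
  fold_right (fun n A => Prod (Var n) A) One w.

Definition srs (T : Type) := list (list T * list T).

Inductive rewrite_step {T} (R : srs T) : list T -> list T -> Prop :=
| rewrite_at w1 u v w2 : In (u, v) R ->
    rewrite_step R (w1 ++ u ++ w2) (w1 ++ v ++ w2).

Definition rewrites {T} (R : srs T) := clos_refl_trans _ (rewrite_step R).

Lemma rewrites_rule {T} (R : srs T) u v : In (u, v) R -> rewrites R u v.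
Proof.
  intros H. apply rt_step. pose proof (rewrite_at R [] u v [] H) as Hs.
  now rewrite !app_nil_r in Hs.
Qed.

Lemma rewrites_ctx {T} (R : srs T) w1 u v w2 :
  rewrites R u v -> rewrites R (w1 ++ u ++ w2) (w1 ++ v ++ w2).
Proof.
  induction 1 as [u v [l u' v' r H]| |u v w _ IH1 _ IH2].
  - apply rt_step. rewrite <- !app_assoc, !(app_assoc w1).
    now constructor.
  - apply rt_refl.
  - exact (rt_trans _ _ _ _ _ IH1 IH2).
Qed.

Definition map_srs {T U} (f : T -> U) (R : srs T) : srs U :=
  map (fun r => (map f (fst r), map f (snd r))) R.

Lemma rewrites_map {T U} (f : T -> U) (R : srs T) w w' :
  rewrites R w w' -> rewrites (map_srs f R) (map f w) (map f w').
Proof.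
  induction 1 as [u v [l u' v' r H]| |u v w _ IH1 _ IH2].
  - apply rt_step. rewrite !map_app. constructor.
    apply (in_map (fun r => (map f (fst r), map f (snd r)))) in H. exact H.
  - apply rt_refl.
  - exact (rt_trans _ _ _ _ _ IH1 IH2).
Qed.

Definition ticket : formula := Dia (Dia One).

Definition rule_formula (r : list nat * list nat) : formula :=
  Under (prodw (fst r)) (prodw (snd r)).

Definition move_formula (n : nat) : formula :=
  Under (Var n) (Prod ticket (Var n)).

Definition instances (alph : list nat) (R : srs nat) : list formula :=
  One :: Prod ticket ticket :: map move_formula alph ++ map rule_formula R.

(** The bang makes [discard B] valid in the model: every relation in the denotation of [reusable B]
    contains equality. *)
Definition reusable (B : formula) : formula := Bang (Binv B).

Definition discard (B : formula) : formula := Over One (reusable B).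

(** Read upwards, !L loads each [reusable B] into the stoup, where contraction can copy it any
    number of times; the matching [discard B] consumes it at the end. *)
Definition program (alph : list nat) (R : srs nat) : list tree :=
  TF ticket ::
  map (fun B => TF (Bang (reusable B))) (instances alph R) ++
  map (fun B => TF (discard B)) (instances alph R).

(** * From rewriting to derivations *)

Section Completeness.

Lemma word_app w1 w2 : word (w1 ++ w2) = word w1 ++ word w2.
Proof. apply map_app. Qed.

Lemma der_prodw w : der ([], word w) (prodw w).
Proof.
  induction w as [|n w IH]; simpl; [constructor|].
  apply (r_prodR [] [] [] [TF (Var n)]); [constructor|exact IH|constructor].
Qed.

Lemma der_prodw_left z G1 w G2 C :
  der (z, G1 ++ word w ++ G2) C -> der (z, G1 ++ TF (prodw w) :: G2) C.
Proof.
  revert G1; induction w as [|n w IH]; simpl; intros G1 H.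
  - now apply (r_oneL Hole).
  - apply (r_prodL Hole).
    specialize (IH (G1 ++ [TF (Var n)])). rewrite <- !app_assoc in IH. auto.
Qed.

Lemma use_ticket Z B G1 G2 C :
  In (reusable B) Z ->
  der (Z, G1 ++ TF B :: G2) C -> der (Z, G1 ++ TF ticket :: G2) C.
Proof.
  intros (Z1 & Z2 & HZ)%in_split H.
  apply (r_diaL Hole), (r_diaL (Deep Z G1 Hole G2) [] [] []); simpl.
  apply (r_oneL (Deep Z G1 (Deep [] [] Hole []) G2) [] [] []); simpl.
  apply (r_bangC Hole (Z1 ++ Z2) Z G1 [] G2 (reusable B)).
  { subst Z. apply Permutation_sym, Permutation_middle. }
  (* The copy leaves the inner stoup, loses its bang by passing through that stoup once more, and
     returns as [Binv B] alone in its bracket, ready for the left rule of the bracket inverse. *)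
  apply (r_bangP (Deep Z G1 Hole G2) [] [reusable B] [] [] (reusable B));
    [reflexivity|]; simpl.
  apply (r_bangL (Deep Z G1 Hole G2) [] [Binv B] [] [] (Binv B));
    [reflexivity|]; simpl.
  apply (r_bangP (Deep Z G1 Hole G2) [] [Binv B] [] [] (Binv B));
    [reflexivity|]; simpl.
  now apply (r_binvL Hole).
Qed.

(** The ticket is spent on the move formula of the letter to its left, which absorbs that letter and
    gives it back preceded by a new ticket. The last letter is crossed first, hence the induction
    from the right. *)
Lemma ticket_left Z w G1 G2 C :
  (forall n, In n w -> In (reusable (move_formula n)) Z) ->
  der (Z, G1 ++ TF ticket :: word w ++ G2) C ->
  der (Z, G1 ++ word w ++ TF ticket :: G2) C.
Proof.
  revert G2; induction w as [|n w IH] using rev_ind; intros G2 Hw H; [exact H|].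
  rewrite word_app, <- app_assoc in H |- *; simpl in *.
  rewrite app_assoc.
  change (der (Z, (G1 ++ word w) ++ [TF (Var n)] ++ TF ticket :: G2) C).
  rewrite app_assoc.
  apply use_ticket with (move_formula n); [apply Hw, in_elt|].
  rewrite <- app_assoc.
  apply (r_underL Hole Z [] Z); [constructor| |reflexivity].
  apply (r_prodL Hole); simpl. rewrite <- app_assoc.
  apply IH; [intros; apply Hw, in_app_iff; auto|exact H].
Qed.

Variables (alph : list nat) (R : srs nat).
Let Z := map reusable (instances alph R).

Lemma reusable_instance B : In B (instances alph R) -> In (reusable B) Z.
Proof. apply in_map. Qed.

Lemma rewrite_step_der w w' G C :
  rewrite_step R w w' -> incl w alph ->
  der (Z, word w' ++ TF ticket :: G) C -> der (Z, word w ++ TF ticket :: G) C.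
Proof.
  intros [w1 u v w2 HR] Hw H.
  (* One copy of the ticket stays at the right end for later steps; the other travels left across
     [w2] and is turned into the rule next to [u]. *)
  apply use_ticket with (Prod ticket ticket).
  { apply reusable_instance; simpl; auto. }
  apply (r_prodL Hole); simpl.
  rewrite !word_app, <- !app_assoc in H |- *. rewrite app_assoc.
  apply ticket_left.
  { intros n Hn. apply reusable_instance. right; right. apply in_app_iff; left.
    apply in_map, Hw. rewrite !in_app_iff; auto. }
  apply use_ticket with (rule_formula (u, v)).
  { apply reusable_instance. right; right. apply in_app_iff; right.
    now apply in_map. }
  rewrite <- app_assoc.
  apply (r_underL Hole Z [] Z); [apply der_prodw| |reflexivity].
  now apply der_prodw_left.
Qed.

Lemma rewrites_der w w' G C :
  (forall u v, In (u, v) R -> incl v alph) ->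
  rewrites R w w' -> incl w alph ->
  der (Z, word w' ++ TF ticket :: G) C -> der (Z, word w ++ TF ticket :: G) C.
Proof.
  intros HR Hs Hw. apply clos_rt_rt1n in Hs.
  induction Hs as [w|w w1 w2 Hs _ IH]; [auto|]. intros H.
  apply (rewrite_step_der w w1); auto. apply IH; [|exact H].
  destruct Hs as [l u v r Hr]. apply HR in Hr.
  intros n Hn. rewrite !in_app_iff in Hn.
  destruct Hn as [Hn|[Hn|Hn]]; auto; apply Hw; rewrite !in_app_iff; auto.
Qed.

(** By !P each stoup formula is placed just after its own [discard B], whose argument it becomes. *)
Lemma der_discard Bs G C :
  der ([], G) C ->
  der (map reusable Bs, G ++ map (fun B => TF (discard B)) Bs) C.
Proof.
  intros H; induction Bs as [|B Bs IH]; simpl; [now rewrite app_nil_r|].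
  change (der (reusable B :: map reusable Bs,
    G ++ [TF (discard B)] ++ map (fun B => TF (discard B)) Bs) C).
  rewrite app_assoc.
  apply (r_bangP Hole (map reusable Bs) _ _ _ (reusable B)); [reflexivity|]; simpl.
  rewrite <- app_assoc.
  apply (r_overL Hole _ [] (map reusable Bs) [TF (reusable B)]); [constructor| |reflexivity].
  now apply (r_oneL Hole).
Qed.

Lemma der_load Bs z G W C :
  der (map reusable Bs ++ z, G ++ W) C ->
  der (z, G ++ map (fun B => TF (Bang (reusable B))) Bs ++ W) C.
Proof.
  revert G; induction Bs as [|B Bs IH]; intros G H; [exact H|].
  change (der (z, G ++ [TF (Bang (reusable B))] ++
    map (fun B => TF (Bang (reusable B))) Bs ++ W) C).
  rewrite app_assoc. apply IH. rewrite <- app_assoc.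
  now apply (r_bangL Hole _ _ _ _ _ _ (Permutation_refl _)).
Qed.

Theorem rewrites_derivable w w' C :
  (forall u v, In (u, v) R -> incl v alph) -> incl w alph ->
  rewrites R w w' -> der ([], word w') C ->
  der ([], word w ++ program alph R) C.
Proof.
  intros HR Hw Hs H. unfold program.
  change (der ([], word w ++ [TF ticket] ++
    map (fun B => TF (Bang (reusable B))) (instances alph R) ++
    map (fun B => TF (discard B)) (instances alph R)) C).
  rewrite app_assoc. apply der_load. rewrite app_nil_r, <- app_assoc.
  apply (rewrites_der w w'); auto.
  (* Rewriting is finished: the remaining ticket is erased by the instance [One]. *)
  apply use_ticket with One; [apply reusable_instance; now left|].
  apply (r_oneL Hole). now apply der_discard.
Qed.

End Completeness.

(** * From derivations to inclusions of relations *)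

Section Faithfulness.

Variables (St : Type) (val : nat -> St -> St -> Prop).

Fixpoint wrel (w : list nat) : St -> St -> Prop :=
  match w with
  | [] => eq
  | n :: w => rcomp St (val n) (wrel w)
  end.

Lemma seqI_word w : seqI St val (word w) (wrel w).
Proof.
  induction w as [|n w IH]; simpl; [now intros s t|].
  exists (val n), (wrel w). auto using rincl_refl.
Qed.

Lemma fI_prodw w P : fI St val (prodw w) P <-> rincl St (wrel w) P.
Proof.
  revert P; induction w as [|n w IH]; simpl; intros P; [reflexivity|]; split.
  - intros (U & V & HU & HV & HP). apply IH in HV.
    eapply rincl_trans; [|exact HP]. now apply rincl_comp.
  - intros H. exists (val n), (wrel w). rewrite IH. auto using rincl_refl.
Qed.

Lemma valid_ticket : valid St val ticket.
Proof. now intros s t. Qed.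

(** With brackets read as the identity, [ticket] means the same as [One], so duplicating and moving
    tickets come down to unit laws. Only the rule formulae call on the hypothesis about [R]. *)
Lemma valid_instances alph R :
  (forall u v, In (u, v) R -> rincl St (wrel v) (wrel u)) ->
  Forall (valid St val) (instances alph R).
Proof.
  intros HR. constructor; [now intros s t|]. constructor.
  { exists eq, eq. repeat split; try apply valid_ticket. apply rcomp_eq_l. }
  apply Forall_app; split; apply Forall_forall; intros A HA;
    apply in_map_iff in HA as (x & <- & Hx).
  - intros P HP. exists eq, P. repeat split; [apply valid_ticket|exact HP|].
    eapply rincl_trans; [apply rcomp_eq_l|apply rcomp_eq_r'].
  - destruct x as [u v]. intros P HP. apply fI_prodw. apply fI_prodw in HP.
    eapply rincl_trans; [exact (HR u v Hx)|].
    eapply rincl_trans; [exact HP|apply rcomp_eq_r'].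
Qed.

Lemma seqI_Forall G : Forall (fun t => tI St val t eq) G -> seqI St val G eq.
Proof.
  induction 1 as [|t G Ht _ IH]; [now intros s t|].
  exists eq, eq. auto using rcomp_eq_l.
Qed.

Lemma seqI_program alph R :
  (forall u v, In (u, v) R -> rincl St (wrel v) (wrel u)) ->
  seqI St val (program alph R) eq.
Proof.
  intros HR. pose proof (valid_instances alph R HR) as HI.
  apply seqI_Forall. constructor; [apply valid_ticket|].
  apply Forall_app; split; apply Forall_map; revert HI; apply Forall_impl;
    intros B HB.
  - repeat split; auto using rincl_refl.
  - intros P [HP _]. eapply rincl_trans; [exact HP|apply rcomp_eq_l'].
Qed.

(** The program part contains equality, so soundness may be applied to the antecedent at [wrel w]
    itself; the succedent denotes the relations above [wrel w']. *)
Theorem derivable_faithful alph R w w' :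
  (forall u v, In (u, v) R -> rincl St (wrel v) (wrel u)) ->
  der ([], word w ++ program alph R) (prodw w') ->
  rincl St (wrel w') (wrel w).
Proof.
  intros HR H. apply fI_prodw.
  apply (soundness St val _ _ H). split; [constructor|]. apply seqI_app.
  exists (wrel w), eq. auto using seqI_word, seqI_program, rcomp_eq_r.
Qed.

End Faithfulness.

(** * Injectivity of the encodings *)

(** Factors 2 are removed from both sides together; when exactly one exponent is 0, parity
    decides. *)
Lemma pow2_odd_inj a : forall b c d,
  2 ^ a * (2 * b + 1) = 2 ^ c * (2 * d + 1) -> a = c /\ b = d.
Proof.
  induction a as [|a IH]; intros b [|c] d; rewrite ?Nat.pow_succ_r', <- ?Nat.mul_assoc.
  - simpl Nat.pow. lia.
  - change (2 ^ 0) with 1. generalize (2 ^ c * (2 * d + 1)). lia.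
  - change (2 ^ 0) with 1. generalize (2 ^ a * (2 * b + 1)). lia.
  - intros H. destruct (IH b c d) as [-> ->]; [lia|auto].
Qed.

Lemma S_npair a b : S (npair a b) = 2 ^ a * (2 * b + 1).
Proof.
  unfold npair.
  enough (2 ^ a * (2 * b + 1) <> 0) by lia.
  apply Nat.neq_mul_0. split; [now apply Nat.pow_nonzero|lia].
Qed.

Lemma npair_inj a b c d : npair a b = npair c d -> a = c /\ b = d.
Proof. intros H. apply pow2_odd_inj. rewrite <- !S_npair. congruence. Qed.

Lemma enc_formula_inj A : forall B, enc_formula A = enc_formula B -> A = B.
Proof.
  induction A; intros []; cbn [enc_formula]; intros H; apply npair_inj in H as [H1 H2];
    try discriminate; try (apply npair_inj in H2 as [H2 H3]); f_equal; auto.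
Qed.

Lemma enc_list_inj {T} (e : T -> nat) l :
  Forall (fun x => forall y, e x = e y -> x = y) l ->
  forall l', enc_list e l = enc_list e l' -> l = l'.
Proof.
  induction 1 as [|x l Hx _ IH]; intros [|y l']; simpl; try discriminate; auto.
  intros [=H]. apply npair_inj in H as [H1 H2]. f_equal; auto.
Qed.

Lemma enc_formulas_inj z z' :
  enc_list enc_formula z = enc_list enc_formula z' -> z = z'.
Proof. apply enc_list_inj, Forall_forall. intros; now apply enc_formula_inj. Qed.

Lemma enc_tree_bracket z G :
  enc_tree (TB z G) = npair 1 (npair (enc_list enc_formula z) (enc_list enc_tree G)).
Proof.
  cbn [enc_tree]. do 2 f_equal. induction G as [|t G IH]; cbn; [|rewrite IH]; reflexivity.
Qed.

(** A direct fixpoint, because the generated induction principle of [tree] gives no hypothesis for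
    the trees inside a bracket. *)
Fixpoint enc_tree_inj t : forall t', enc_tree t = enc_tree t' -> t = t'.
Proof.
  destruct t as [A|z G]; intros [A'|z' G']; rewrite ?enc_tree_bracket;
    try (intros [H _]%npair_inj; discriminate).
  - intros [_ H]%npair_inj. f_equal. now apply enc_formula_inj.
  - intros [_ [H1 H2]%npair_inj]%npair_inj. f_equal; [now apply enc_formulas_inj|].
    revert G' H2. apply enc_list_inj. clear - enc_tree_inj.
    induction G; constructor; auto.
Qed.

Lemma enc_sequent_inj m C m' C' :
  enc_sequent m C = enc_sequent m' C' -> m = m' /\ C = C'.
Proof.
  destruct m as [z G], m' as [z' G'].
  intros [[H1 H2]%npair_inj H3]%npair_inj; simpl in *.
  apply enc_formulas_inj in H1 as ->. apply enc_formula_inj in H3 as ->.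
  apply enc_list_inj in H2 as ->; [auto|].
  apply Forall_forall. intros; now apply enc_tree_inj.
Qed.

(** * Loop programs as rewriting systems *)

Definition state := nat -> nat.

Definition upd (s : state) (r v : nat) : state :=
  fun x => if x =? r then v else s x.

Inductive cmd : Type :=
| Skip : cmd
| Inc : nat -> cmd
| Zero : nat -> cmd
| Seq : cmd -> cmd -> cmd
| Loop : nat -> cmd -> cmd.

(** [Loop r c] decrements [r] before each run of [c] and stops when [r] is 0; as [c] may refill [r],
    it is an unbounded loop. The decrement is expressed by writing the earlier state as an
    increment. [Zero r] is a test that blocks on a positive register. *)
Inductive exec : cmd -> state -> state -> Prop :=
| exec_Skip s : exec Skip s s
| exec_Inc r s : exec (Inc r) s (upd s r (S (s r)))
| exec_Zero r s : s r = 0 -> exec (Zero r) s s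
| exec_Seq c d s t u : exec c s t -> exec d t u -> exec (Seq c d) s u
| exec_Loop0 r c s : s r = 0 -> exec (Loop r c) s s
| exec_LoopS r c s t u :
    exec c s t -> exec (Loop r c) t u ->
    exec (Loop r c) (upd s r (S (s r))) u.

Lemma upd_same s r v : upd s r v r = v.
Proof. unfold upd. now rewrite Nat.eqb_refl. Qed.

Lemma upd_inc_inj s t r :
  upd s r (S (s r)) = upd t r (S (t r)) -> s = t.
Proof.
  intros H. extensionality x. pose proof (equal_f H x) as Hx.
  unfold upd in Hx. destruct (Nat.eqb_spec x r); [subst|]; congruence.
Qed.

Lemma exec_det c s t : exec c s t -> forall u, exec c s u -> t = u.
Proof.
  induction 1; intros v Hv.
  - now inversion Hv.
  - now inversion Hv.
  - now inversion Hv.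
  - inversion Hv; subst. apply IHexec2. erewrite IHexec1; eauto.
  - inversion Hv; subst; [reflexivity|]. rewrite upd_same in H. discriminate.
  - inversion Hv; subst.
    + rewrite upd_same in *. discriminate.
    + match goal with H : upd _ _ _ = upd _ _ _ |- _ => apply upd_inc_inj in H as -> end.
      apply IHexec2. erewrite IHexec1; eauto.
Qed.

(** [Start] pins the run to the zero state, and the increments after it build the input. [Havoc]
    relates all states and so forgets the final one. *)
Inductive token : Type :=
| Start : token
| Havoc : token
| Do : cmd -> token.

Definition trel (k : token) (s t : state) : Prop :=
  match k with
  | Start => s = (fun _ => 0) /\ t = (fun _ => 0)
  | Havoc => True
  | Do c => exec c s t
  end.

(* Any injection of commands into formulae would do: it is only used to give
   the commands distinct codes. *)
Fixpoint cmd_formula (c : cmd) : formula :=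
  match c with
  | Skip => One
  | Inc r => Var r
  | Zero r => Bang (Var r)
  | Seq c d => Prod (cmd_formula c) (cmd_formula d)
  | Loop r c => Over (cmd_formula c) (Var r)
  end.

Lemma cmd_formula_inj c : forall d, cmd_formula c = cmd_formula d -> c = d.
Proof.
  induction c; intros []; simpl; try discriminate; intros [=]; subst; f_equal; auto.
Qed.

Definition code (k : token) : nat :=
  match k with
  | Start => 0
  | Havoc => 1
  | Do c => S (S (enc_formula (cmd_formula c)))
  end.

Lemma code_inj k l : code k = code l -> k = l.
Proof.
  destruct k, l; simpl; try discriminate; auto. intros [=H].
  f_equal. now apply cmd_formula_inj, enc_formula_inj.
Qed.

Definition code_rel (n : nat) (s t : state) : Prop :=
  exists k, code k = n /\ trel k s t.

Lemma code_rel_code k s t : code_rel (code k) s t <-> trel k s t.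
Proof.
  split; [intros (l & <-%code_inj & H)|exists k]; auto.
Qed.

Fixpoint krel (w : list token) : state -> state -> Prop :=
  match w with
  | [] => eq
  | k :: w => rcomp state (trel k) (krel w)
  end.

Lemma wrel_codes w s t : wrel state code_rel (map code w) s t <-> krel w s t.
Proof.
  revert s; induction w as [|k w IH]; simpl; [reflexivity|]. intros s.
  split; intros (m & H1 & H2); exists m; split;
    (now apply code_rel_code) || now apply IH.
Qed.

Fixpoint regs (c : cmd) : list nat :=
  match c with
  | Skip => []
  | Inc r => [r]
  | Zero r => [r]
  | Seq c d => regs c ++ regs d
  | Loop r c => r :: regs c
  end.

Fixpoint subcmds (c : cmd) : list cmd :=
  c :: match c with
       | Seq c d => subcmds c ++ subcmds d
       | Loop _ c => subcmds c
       | _ => []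
       end.

Definition rule := (list token * list token)%type.

Definition inc (r : nat) : token := Do (Inc r).
Definition incs (l : list nat) : list token := map inc l.

(** A configuration is [Start], then units of registers, then the remaining commands. A loop either
    guesses that its register is empty and leaves a test, or consumes a unit standing next to it. *)
Definition cmd_rules (c : cmd) : list rule :=
  match c with
  | Skip => [([Do Skip], [])]
  | Inc r => []
  | Zero r => []
  | Seq c d => [([Do (Seq c d)], [Do c; Do d])]
  | Loop r c => [([Do (Loop r c)], [Do (Zero r)]);
                 ([inc r; Do (Loop r c)], [Do c; Do (Loop r c)])]
  end.

Definition reg_rules (r : nat) : list rule :=
  [([inc r; Havoc], [Havoc]); ([Start; Do (Zero r)], [Start])].

(** Units commute, so any of them can be brought to a loop. A zero test passes leftwards over units
    of other registers only, so reaching [Start] certifies that its register is empty. *)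
Definition pair_rules (p : nat * nat) : list rule :=
  let (r, s) := p in
  ([inc r; inc s], [inc s; inc r]) ::
  if r =? s then [] else [([inc r; Do (Zero s)], [Do (Zero s); inc r])].

Definition rules (L : list nat) (c : cmd) : list rule :=
  flat_map cmd_rules (subcmds c) ++ flat_map reg_rules L ++
  flat_map pair_rules (list_prod L L).

Lemma trel_inc r s t : trel (inc r) s t <-> t = upd s r (S (s r)).
Proof.
  split; [intros H; now inversion H|intros ->; constructor].
Qed.

Lemma upd_comm s p q a b : p <> q -> upd (upd s p a) q b = upd (upd s q b) p a.
Proof.
  intros H. extensionality x. unfold upd.
  destruct (Nat.eqb_spec x q), (Nat.eqb_spec x p); congruence.
Qed.

Lemma upd_other s r v x : x <> r -> upd s r v x = s x.
Proof. intros H. unfold upd. now destruct (Nat.eqb_spec x r). Qed.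

Lemma upd_inc_comm s p q :
  upd (upd s p (S (s p))) q (S (upd s p (S (s p)) q)) =
  upd (upd s q (S (s q))) p (S (upd s q (S (s q)) p)).
Proof.
  destruct (Nat.eq_dec p q) as [->|H]; [reflexivity|].
  rewrite upd_comm, !upd_other by auto. reflexivity.
Qed.

(** The command rules unfold clauses of [exec], and the swaps hold because the operations commute.
    [Havoc] absorbs a unit since it relates everything, and [Start] absorbs a zero test since it
    ends in the zero state. *)
Lemma rules_sound L c u v s t :
  In (u, v) (rules L c) -> krel v s t -> krel u s t.
Proof.
  unfold rules. rewrite !in_app_iff, !in_flat_map.
  assert (Hswap : forall p q, krel [inc q; inc p] s t -> krel [inc p; inc q] s t).
  { intros p q (m & ->%trel_inc & m' & ->%trel_inc & <-).
    eexists; split; [now apply trel_inc|]. eexists; split; [|reflexivity].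
    apply trel_inc, upd_inc_comm. }
  intros [([] & _ & H)|[(r & _ & H)|([p q] & _ & H)]]; simpl in H;
    try destruct (Nat.eqb_spec p q) as [|Hpq]; simpl in H;
    repeat destruct H as [[= <- <-]|H]; try contradiction; auto.
  - intros <-. exists s; split; constructor.
  - intros (m & H1 & m' & H2 & <-). exists m'; split; [|reflexivity].
    econstructor; [exact H1|exact H2].
  - intros (m & H & <-). exists m; split; [|reflexivity].
    inversion H; subst. now constructor.
  - intros (m & H1 & m' & H2 & <-).
    eexists; split; [now apply trel_inc|]. exists m'; split; [|reflexivity].
    econstructor; [exact H1|exact H2].
  - intros _. eexists; split; [now apply trel_inc|]. now exists t.
  - intros (m & [-> ->] & <-). exists (fun _ => 0); split; [now split|].
    exists (fun _ => 0); split; [now constructor|reflexivity].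
  - intros (m & H1 & m' & ->%trel_inc & <-). inversion H1; subst.
    eexists; split; [now apply trel_inc|]. eexists; split; [|reflexivity].
    constructor. rewrite upd_other; auto.
Qed.

Definition state_of (l : list nat) : state := count_occ Nat.eq_dec l.

Lemma state_of_snoc l r : state_of (l ++ [r]) = upd (state_of l) r (S (state_of l r)).
Proof.
  extensionality x. unfold state_of, upd. rewrite count_occ_app. simpl.
  destruct (Nat.eq_dec r x), (Nat.eqb_spec x r); subst; try congruence; lia.
Qed.

Lemma state_of_middle l1 r l2 :
  state_of (l1 ++ r :: l2) = state_of ((l1 ++ l2) ++ [r]).
Proof.
  extensionality x. unfold state_of. rewrite !count_occ_app. simpl.
  destruct (Nat.eq_dec r x); lia.
Qed.

(** * Runs of programs carried out by rewriting *)

Section Execution.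

Variables (L : list nat) (c0 : cmd).

Notation "u ~> v" := (rewrites (rules L c0) u v) (at level 70).

Lemma rewrites_trans u v w : u ~> v -> v ~> w -> u ~> w.
Proof. apply rt_trans. Qed.

Lemma cmd_rule c u v : In c (subcmds c0) -> In (u, v) (cmd_rules c) -> u ~> v.
Proof.
  intros Hc H. apply rewrites_rule. unfold rules.
  rewrite !in_app_iff, !in_flat_map. left; exists c; auto.
Qed.

Lemma reg_rule r u v : In r L -> In (u, v) (reg_rules r) -> u ~> v.
Proof.
  intros Hr H. apply rewrites_rule. unfold rules.
  rewrite !in_app_iff, !in_flat_map. right; left; exists r; auto.
Qed.

Lemma pair_rule r s u v :
  In r L -> In s L -> In (u, v) (pair_rules (r, s)) -> u ~> v.
Proof.
  intros Hr Hs H. apply rewrites_rule. unfold rules.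
  rewrite !in_app_iff, !in_flat_map. right; right; exists (r, s).
  split; [now apply in_prod|exact H].
Qed.

Lemma incs_right r l :
  In r L -> incl l L -> incs (r :: l) ~> incs (l ++ [r]).
Proof.
  intros Hr; induction l as [|s l IH]; intros Hl; [apply rt_refl|].
  apply rewrites_trans with (inc s :: incs (r :: l)).
  - apply (rewrites_ctx _ [] [inc r; inc s] [inc s; inc r] (incs l)).
    apply (pair_rule r s); [auto|apply Hl; now left|now left].
  - apply (rewrites_ctx _ [inc s] _ _ []) in IH; [|now apply incl_cons_inv in Hl].
    now rewrite !app_nil_r in IH.
Qed.

Lemma zero_left r l :
  In r L -> incl l L -> ~ In r l -> Start :: incs l ++ [Do (Zero r)] ~> Start :: incs l.
Proof.
  intros Hr; induction l as [|s l IH] using rev_ind; intros Hl Hrl.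
  - apply (reg_rule r); simpl; auto.
  - unfold incs. rewrite map_app, <- app_assoc.
    apply incl_app_inv in Hl as [Hl Hs]. rewrite in_app_iff in Hrl.
    apply rewrites_trans with (Start :: incs l ++ [Do (Zero r); inc s]).
    + apply (rewrites_ctx _ (Start :: incs l) [inc s; Do (Zero r)] [Do (Zero r); inc s] []).
      apply (pair_rule s r); [apply Hs; now left|auto|].
      right. destruct (Nat.eqb_spec s r); [|now left].
      exfalso; subst; apply Hrl; simpl; auto.
    + apply (rewrites_ctx _ [] _ _ [inc s]) in IH; auto. simpl in IH.
      now rewrite <- app_assoc in IH.
Qed.

Lemma havoc_left l : incl l L -> incs l ++ [Havoc] ~> [Havoc].
Proof.
  induction l as [|s l IH] using rev_ind; intros Hl; [apply rt_refl|].
  apply incl_app_inv in Hl as [Hl Hs].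
  unfold incs. rewrite map_app, <- app_assoc.
  eapply rewrites_trans; [|exact (IH Hl)].
  apply (rewrites_ctx _ (incs l) [inc s; Havoc] [Havoc] []).
  apply (reg_rule s); [apply Hs; now left|now left].
Qed.

Lemma subcmds_self c : In c (subcmds c).
Proof. destruct c; now left. Qed.

(** A state is represented by any list with the right multiplicities, so the induction ranges over
    all such [l], and the resulting order of units is left open. *)
Lemma exec_rewrites c s t :
  exec c s t -> incl (subcmds c) (subcmds c0) -> incl (regs c) L ->
  forall l, incl l L -> state_of l = s ->
  exists l', incl l' L /\ state_of l' = t /\
    Start :: incs l ++ [Do c] ~> Start :: incs l'.
Proof.
  induction 1 as [s|r s|r s Hr|c d s t u H1 IH1 H2 IH2|r c s Hr|r c s t u H1 IH1 H2 IH2];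
    intros Hc HL l Hl Hs.
  - exists l; repeat split; auto.
    pose proof (rewrites_ctx (rules L c0) (Start :: incs l) [Do Skip] [] []) as H.
    rewrite !app_nil_r in H. apply H.
    apply (cmd_rule Skip); [apply Hc, subcmds_self|now left].
  (* [Do (Inc r)] is already a unit of [r]: the command becomes data without any rewriting. *)
  - exists (l ++ [r]); repeat split; [now apply incl_app| |].
    + now rewrite state_of_snoc, Hs.
    + unfold incs. rewrite map_app. apply rt_refl.
  - exists l; repeat split; auto. apply zero_left; auto.
    + apply HL. now left.
    + apply (count_occ_not_In Nat.eq_dec). now subst.
  - apply incl_app_inv in HL as [HLc HLd].
    pose proof (Hc _ (subcmds_self _)) as Hcd.
    apply incl_cons_inv in Hc as [_ [Hcc Hd]%incl_app_inv].
    destruct (IH1 Hcc HLc l Hl Hs) as (l1 & Hl1 & Hs1 & R1).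
    destruct (IH2 Hd HLd l1 Hl1 Hs1) as (l2 & Hl2 & Hs2 & R2).
    exists l2; repeat split; auto. eapply rewrites_trans; [|exact R2].
    apply (rewrites_ctx _ [] _ _ [Do d]) in R1. simpl in R1.
    eapply rewrites_trans; [|exact R1]. rewrite <- app_assoc.
    apply (rewrites_ctx _ (Start :: incs l) [Do (Seq c d)] [Do c; Do d] []).
    apply (cmd_rule (Seq c d)); [exact Hcd|now left].
  - exists l; repeat split; auto.
    apply rewrites_trans with (Start :: incs l ++ [Do (Zero r)]).
    + apply (rewrites_ctx _ (Start :: incs l) [Do (Loop r c)] [Do (Zero r)] []).
      apply (cmd_rule (Loop r c)); [apply Hc, subcmds_self|now left].
    + apply zero_left; auto; [apply HL; now left|].
      apply (count_occ_not_In Nat.eq_dec). now subst.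
  (* The register [r] is positive in the source state, so [l] contains a unit of [r]; it is moved
     next to the loop and consumed there. *)
  - assert (Hrl : In r l).
    { apply (count_occ_In Nat.eq_dec). apply (f_equal (fun s => s r)) in Hs.
      rewrite upd_same in Hs. unfold state_of in Hs. lia. }
    apply in_split in Hrl as (l1 & l2 & ->).
    rewrite state_of_middle, state_of_snoc in Hs. apply upd_inc_inj in Hs.
    pose proof (Hc _ (subcmds_self _)) as Hloop.
    apply incl_app_inv in Hl as [Hl1 [HrL Hl2]%incl_cons_inv].
    destruct (IH1 (proj2 (incl_cons_inv Hc)) (proj2 (incl_cons_inv HL)) (l1 ++ l2)
                (incl_app Hl1 Hl2) Hs) as (l3 & Hl3 & Hs3 & R1).
    destruct (IH2 Hc HL l3 Hl3 Hs3) as (l4 & Hl4 & Hs4 & R2).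
    exists l4; repeat split; auto. eapply rewrites_trans; [|exact R2].
    apply (rewrites_ctx _ [] _ _ [Do (Loop r c)]) in R1. simpl in R1.
    eapply rewrites_trans; [|exact R1]. rewrite <- app_assoc.
    apply rewrites_trans with (Start :: incs (l1 ++ l2) ++ [inc r; Do (Loop r c)]).
    + unfold incs. rewrite !map_app, <- !app_assoc.
      pose proof (incs_right r l2 HrL Hl2) as R3.
      apply (rewrites_ctx _ (Start :: incs l1) _ _ [Do (Loop r c)]) in R3.
      unfold incs in R3. rewrite map_app, <- app_assoc in R3. exact R3.
    + apply (rewrites_ctx _ (Start :: incs (l1 ++ l2)) [inc r; Do (Loop r c)]
               [Do c; Do (Loop r c)] []).
      apply (cmd_rule (Loop r c)); [exact Hloop|right; now left].
Qed.

(** After the run the zero test checks the result, and then [Havoc] erases all units, so the last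
    word does not depend on the final state. *)
Lemma halt_rewrites l c s t r :
  exec c s t -> t r = 0 -> incl (subcmds c) (subcmds c0) -> incl (regs c) L ->
  In r L -> incl l L -> state_of l = s ->
  Start :: incs l ++ [Do c; Do (Zero r); Havoc] ~> [Start; Havoc].
Proof.
  intros He Hr Hc HL HrL Hl Hs.
  destruct (exec_rewrites c s t He Hc HL l Hl Hs) as (l' & Hl' & Hs' & R1).
  apply (rewrites_ctx _ [] _ _ [Do (Zero r); Havoc]) in R1. simpl in R1.
  rewrite <- app_assoc in R1. eapply rewrites_trans; [exact R1|].
  assert (Hrl : ~ In r l').
  { apply (count_occ_not_In Nat.eq_dec). now subst. }
  pose proof (zero_left r l' HrL Hl' Hrl) as R2.
  apply (rewrites_ctx _ [] _ _ [Havoc]) in R2. simpl in R2.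
  rewrite <- app_assoc in R2. eapply rewrites_trans; [exact R2|].
  pose proof (havoc_left l' Hl') as R3.
  apply (rewrites_ctx _ [Start] _ _ []) in R3. now rewrite !app_nil_r in R3.
Qed.

End Execution.

(** * Sequents expressing that a program returns 0 *)

Definition program_regs (c : cmd) : list nat := 0 :: 1 :: regs c.

Definition program_srs (c : cmd) : srs nat := map_srs code (rules (program_regs c) c).

(** Register 0 holds the input and register 1 the output; the test blocks every run with a positive
    output. *)
Definition final_tokens (c : cmd) : list token := [Do c; Do (Zero 1); Havoc].

(** The letters of the initial word and of all right-hand sides: those that a ticket may have to
    cross. *)
Definition program_alphabet (c : cmd) : list nat :=
  map code (Start :: inc 0 :: final_tokens c) ++ flat_map snd (program_srs c).

(** The part of the sequent that is independent of the input; its code will later serve as the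
    input. *)
Definition program_tail (c : cmd) : list tree :=
  word (map code (final_tokens c)) ++ program (program_alphabet c) (program_srs c).

Definition halting_seq (n : nat) (tail : list tree) : list tree :=
  TF (Var (code Start)) :: repeat (TF (Var (code (inc 0)))) n ++ tail.

Definition halting_goal : formula := prodw (map code [Start; Havoc]).

Definition input (n : nat) : state := upd (fun _ => 0) 0 n.

Lemma state_of_repeat n : state_of (repeat 0 n) = input n.
Proof.
  extensionality x. unfold state_of, input, upd.
  destruct (Nat.eqb_spec x 0) as [->|H].
  - now apply count_occ_repeat_eq.
  - apply count_occ_repeat_neq. auto.
Qed.

Lemma halting_seq_word n c :
  halting_seq n (program_tail c) =
  word (map code (Start :: incs (repeat 0 n) ++ final_tokens c)) ++
  program (program_alphabet c) (program_srs c).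
Proof.
  unfold halting_seq, program_tail, incs, word.
  rewrite !map_cons, !map_app. simpl. rewrite !map_repeat, <- app_assoc.
  reflexivity.
Qed.

Theorem halting_derivable c n t :
  exec c (input n) t -> t 1 = 0 ->
  der ([], halting_seq n (program_tail c)) halting_goal.
Proof.
  intros He Ht. rewrite halting_seq_word.
  apply rewrites_derivable with (map code [Start; Havoc]).
  - intros u v Huv. apply incl_appr. intros k Hk.
    apply in_flat_map. now exists (u, v).
  - apply incl_appl, incl_map. intros k [<-|[Hk|Hk]%in_app_iff].
    + now left.
    + apply in_map_iff in Hk as (r & <- & ->%repeat_spec). right; now left.
    + right; now right.
  - apply rewrites_map.
    apply (halt_rewrites (program_regs c) c _ c _ t 1 He Ht).
    + apply incl_refl.
    + apply incl_appr with (m := [0; 1]), incl_refl.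
    + right; now left.
    + intros r ->%repeat_spec. now left.
    + apply state_of_repeat.
  - apply der_prodw.
Qed.

Lemma krel_incs n w s t :
  krel (incs (repeat 0 n) ++ w) s t -> krel w (upd s 0 (s 0 + n)) t.
Proof.
  revert s; induction n as [|n IH]; simpl; intros s.
  - replace (upd s 0 (s 0 + 0)) with s; [auto|].
    extensionality x. unfold upd. destruct (Nat.eqb_spec x 0); subst; lia.
  - intros (m & ->%trel_inc & H). apply IH in H. revert H.
    replace (upd (upd s 0 _) 0 _) with (upd s 0 (s 0 + S n)); [auto|].
    extensionality x. unfold upd. destruct (Nat.eqb_spec x 0); subst; simpl; lia.
Qed.

(** Faithfulness includes the relation of [Start] and [Havoc] in that of the initial word. The pair
    of zero states lies in the former, and its membership in the latter is a run of [c] that passes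
    the zero test. *)
Theorem derivable_halting c n :
  der ([], halting_seq n (program_tail c)) halting_goal ->
  exists t, exec c (input n) t /\ t 1 = 0.
Proof.
  rewrite halting_seq_word. intros H.
  apply (derivable_faithful state code_rel) in H.
  - specialize (H (fun _ => 0) (fun _ => 0)).
    rewrite !wrel_codes in H. destruct H as (s & [_ ->] & H).
    { exists (fun _ => 0); split; [now split|]. exists (fun _ => 0); now split. }
    apply krel_incs in H as (t & He & t' & Hz & _).
    exists t; split; [exact He|]. now inversion Hz.
  - intros u v ([u' v'] & [= <- <-] & Huv)%in_map_iff s t.
    rewrite !wrel_codes. now apply (rules_sound (program_regs c) c).
Qed.

(** * Compilation of recursive functions *)

Fixpoint recf_ind' (P : recf -> Prop)
  (HZ : P RZero) (HS : P RSucc) (HP : forall i, P (RProj i))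
  (HC : forall f gs, P f -> Forall P gs -> P (RComp f gs))
  (HR : forall f g, P f -> P g -> P (RPrec f g))
  (HM : forall f, P f -> P (RMu f)) (f : recf) : P f :=
  let IH := recf_ind' P HZ HS HP HC HR HM in
  match f with
  | RZero => HZ
  | RSucc => HS
  | RProj i => HP i
  | RComp f gs =>
      HC f gs (IH f)
        ((fix IHs gs : Forall P gs :=
            match gs with
            | [] => Forall_nil P
            | g :: gs => Forall_cons g (IH g) (IHs gs)
            end) gs)
  | RPrec f g => HR f g (IH f) (IH g)
  | RMu f => HM f (IH f)
  end.

(** A loop destroys its counter, so [i] is emptied into both [o] and the scratch register [b], and
    then restored from [b]. *)
Definition copy (i o b : nat) : cmd :=
  Seq (Loop i (Seq (Inc o) (Inc b))) (Loop b (Inc i)).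

Definition clear (r : nat) : cmd := Loop r Skip.

Definition move (i o : nat) : cmd := Loop i (Inc o).

Fixpoint clears (o k : nat) : cmd :=
  match k with
  | 0 => Skip
  | S k => Seq (clear o) (clears (S o) k)
  end.

Section CompileList.
Variable comp : recf -> nat -> cmd.
Fixpoint compile_list (gs : list recf) (o : nat) : cmd :=
  match gs with
  | [] => Skip
  | g :: gs => Seq (comp g o) (compile_list gs (S o))
  end.
End CompileList.

(* [compile f ins out b] adds to register [out] the value of [f] at the contents
   of the registers [ins]; the registers from [b] on are scratch space, zero
   before and after. *)
Fixpoint compile (f : recf) (ins : list nat) (out b : nat) : cmd :=
  match f with
  | RZero => Skip
  | RSucc =>
      match ins with
      | [] => Skip
      | i :: _ => Seq (copy i out b) (Inc out)
      end
  | RProj n =>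
      match nth_error ins n with
      | Some i => copy i out b
      | None => Skip
      end
  | RComp f gs =>
      let k := length gs in
      Seq (compile_list (fun g o => compile g ins o (b + k)) gs b)
        (Seq (compile f (seq b k) out (b + k)) (clears b k))
  | RPrec f g =>
      match ins with
      | [] => Skip
      | i :: ins =>
          Seq (copy i b (b + 4))
            (Seq (compile f ins (b + 2) (b + 4))
               (Seq (Loop b
                       (Seq (compile g (b + 1 :: b + 2 :: ins) (b + 3) (b + 4))
                          (Seq (clear (b + 2))
                             (Seq (move (b + 3) (b + 2)) (Inc (b + 1))))))
                  (Seq (move (b + 2) out) (clear (b + 1)))))
      end
  | RMu f =>
      Seq (compile f (b :: ins) (b + 1) (b + 2))
        (Seq (Loop (b + 1)
                (Seq (clear (b + 1))
                   (Seq (Inc b) (compile f (b :: ins) (b + 1) (b + 2)))))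
           (move b out))
  end.

Lemma exec_eq c s t u : exec c s t -> t = u -> exec c s u.
Proof. now intros H <-. Qed.

Ltac upd_cases :=
  unfold upd;
  repeat match goal with
  | |- context [Nat.eqb ?a ?b] => destruct (Nat.eqb_spec a b); subst
  end; try lia; auto.

Ltac upd_solve := let x := fresh "x" in extensionality x; upd_cases.

Lemma exec_loop_dec r c s v t u :
  s r = S v -> exec c (upd s r v) t -> exec (Loop r c) t u -> exec (Loop r c) s u.
Proof.
  intros Hs H1 H2. replace s with (upd (upd s r v) r (S (upd s r v r))).
  - econstructor; eauto.
  - rewrite upd_same, <- Hs. upd_solve.
Qed.

Lemma exec_clear r s : exec (clear r) s (upd s r 0).
Proof.
  remember (s r) as v eqn:Hv. symmetry in Hv. revert s Hv.
  induction v as [|v IH]; intros s Hv.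
  - eapply exec_eq; [now constructor|]. upd_solve.
  - eapply exec_loop_dec; [exact Hv|constructor|].
    eapply exec_eq; [apply IH, upd_same|]. upd_solve.
Qed.

Lemma exec_move i o s :
  i <> o -> exec (move i o) s (upd (upd s i 0) o (s o + s i)).
Proof.
  intros Hio. remember (s i) as v eqn:Hv. symmetry in Hv. revert s Hv.
  induction v as [|v IH]; intros s Hv.
  - eapply exec_eq; [now constructor|]. upd_solve.
  - eapply exec_loop_dec; [exact Hv|constructor|].
    eapply exec_eq; [apply IH; upd_cases|upd_solve].
Qed.

Lemma exec_copy i o b s :
  i <> o -> i <> b -> o <> b -> s b = 0 ->
  exec (copy i o b) s (upd s o (s o + s i)).
Proof.
  intros Hio Hib Hob Hb.
  (* The invariant allows any value in [b], which is nonzero after the first round. *)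
  enough (H : forall v s, s i = v ->
    exec (Loop i (Seq (Inc o) (Inc b))) s
      (upd (upd (upd s i 0) o (s o + v)) b (s b + v))).
  { econstructor; [now apply H|].
    eapply exec_eq; [apply exec_move; auto|]. upd_solve.
  }
  clear s Hb. induction v as [|v IH]; intros s Hv.
  - eapply exec_eq; [now constructor|]. upd_solve.
  - eapply exec_loop_dec; [exact Hv|repeat econstructor|].
    eapply exec_eq; [apply IH; upd_cases|upd_solve].
Qed.

Lemma exec_clears o k s :
  exec (clears o k) s (fun x => if ((o <=? x) && (x <? o + k))%bool then 0 else s x).
Proof.
  revert o s; induction k as [|k IH]; intros o s; simpl.
  - eapply exec_eq; [constructor|]. extensionality x.
    destruct (Nat.leb_spec o x), (Nat.ltb_spec x (o + 0)); simpl; auto; lia.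
  - econstructor; [apply exec_clear|]. eapply exec_eq; [apply IH|].
    extensionality x. unfold upd.
    destruct (Nat.leb_spec (S o) x), (Nat.ltb_spec x (S o + k)),
      (Nat.leb_spec o x), (Nat.ltb_spec x (o + S k)), (Nat.eqb_spec x o);
      simpl; auto; lia.
Qed.

(** A frame condition is built in: only [out] changes, so inputs survive and scratch registers are
    zero again, which lets compiled pieces be chained. *)
Definition compiles (f : recf) : Prop :=
  forall xs y, ev f xs y ->
  forall ins out b s,
    map s ins = xs -> (forall i, In i ins -> i < b) -> out < b -> ~ In out ins ->
    (forall r, b <= r -> s r = 0) ->
    exec (compile f ins out b) s (upd s out (s out + y)).

Fixpoint upds (s : state) (o : nat) (ys : list nat) : state :=
  match ys with
  | [] => s
  | y :: ys => upds (upd s o y) (S o) ys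
  end.

Lemma upds_out ys : forall s o r, r < o \/ o + length ys <= r -> upds s o ys r = s r.
Proof.
  induction ys as [|y ys IH]; simpl; intros s o r H; [reflexivity|].
  rewrite IH by lia. apply upd_other. lia.
Qed.

Lemma map_upds ys : forall s o, map (upds s o ys) (seq o (length ys)) = ys.
Proof.
  induction ys as [|y ys IH]; simpl; intros s o; [reflexivity|].
  rewrite IH, upds_out, upd_same by lia. reflexivity.
Qed.

Lemma map_upd s r v l : ~ In r l -> map (upd s r v) l = map s l.
Proof.
  intros H. apply map_ext_in. intros x Hx. apply upd_other. now intros ->.
Qed.

Lemma compile_list_exec gs : Forall compiles gs ->
  forall ins xs ys, evs gs xs ys ->
  forall o b s,
    map s ins = xs -> (forall i, In i ins -> i < o) -> o + length gs <= b ->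
    (forall r, o <= r -> s r = 0) ->
    exec (compile_list (fun g o => compile g ins o b) gs o) s (upds s o ys).
Proof.
  induction 1 as [|g gs Hg _ IH]; intros ins xs ys Hys o b s Hxs Hins Hb Hs;
    inversion Hys; subst; simpl in *; [constructor|].
  econstructor.
  - eapply (Hg _ _ ltac:(eassumption) ins o b); auto; try lia.
    + intros i Hi. specialize (Hins i Hi). lia.
    + intros Ho. specialize (Hins o Ho). lia.
    + intros r Hr. apply Hs. lia.
  - rewrite (Hs o) by lia. simpl. eapply IH; eauto; try lia.
    + apply map_upd. intros Ho. specialize (Hins o Ho). lia.
    + intros i Hi. specialize (Hins i Hi). lia.
    + intros r Hr. rewrite upd_other by lia. apply Hs. lia.
Qed.

(** Evaluation descends from [N], while the compiled loop counts upwards; the table [Y] of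
    intermediate values links the two. *)
Lemma prec_values f g xs N z :
  ev (RPrec f g) (N :: xs) z ->
  exists Y, ev f xs (Y 0) /\ Y N = z /\
    forall n, n < N -> ev g (n :: Y n :: xs) (Y (S n)).
Proof.
  revert z; induction N as [|N IH]; intros z H; inversion H; subst.
  - exists (fun _ => z). repeat split; auto. lia.
  - match goal with H : ev (RPrec f g) _ ?y |- _ =>
      destruct (IH y H) as (Y & HY0 & <- & HY)
    end.
    exists (fun n => if n =? S N then z else Y n). repeat split; auto.
    + now rewrite Nat.eqb_refl.
    + intros n Hn. rewrite (proj2 (Nat.eqb_neq n (S N))) by lia.
      destruct (Nat.eqb_spec (S n) (S N)) as [[= ->]|]; [auto|].
      apply HY. lia.
Qed.

Lemma compile_RComp f gs : compiles f -> Forall compiles gs -> compiles (RComp f gs).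
Proof.
  intros Hf Hgs xs y Hev ins out b s Hxs Hins Hout Hio Hs.
  inversion Hev as [| | |? ? ? ys ? Hys Hy| | |]; subst. simpl.
  assert (Hlen : length gs = length ys).
  { clear - Hys. induction Hys; simpl; congruence. }
  econstructor; [apply (compile_list_exec gs Hgs ins _ ys Hys b (b + length gs)); auto|].
  econstructor.
  - apply (Hf _ _ Hy); try lia.
    + rewrite Hlen. apply map_upds.
    + intros i Hi%in_seq. lia.
    + intros Hi%in_seq. lia.
    + intros r Hr. rewrite upds_out by lia. apply Hs. lia.
  - eapply exec_eq; [apply exec_clears|]. extensionality x.
    destruct (Nat.leb_spec b x), (Nat.ltb_spec x (b + length gs)); simpl;
      [rewrite upd_other, Hs by lia; reflexivity| | |];
      (destruct (Nat.eq_dec x out) as [->|Hx];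
       [rewrite !upd_same|rewrite !upd_other by auto]);
      rewrite upds_out by lia; reflexivity.
Qed.

Lemma compile_RPrec f g : compiles f -> compiles g -> compiles (RPrec f g).
Proof.
  intros Hf Hg xs z Hev [|i ins] out b s Hxs Hins Hout Hio Hs; simpl in Hxs.
  { subst. inversion Hev. }
  subst xs. apply prec_values in Hev as (Y & HY0 & <- & HY). simpl.
  assert (Hi : i < b) by (apply Hins; now left).
  assert (Hins' : forall j, In j ins -> j < b) by (intros; apply Hins; now right).
  assert (Hio' : i <> out /\ ~ In out ins) by (split; intros H; apply Hio; simpl; auto).
  destruct Hio' as [Hio1 Hio2].
  assert (Hout' : forall r, b <= r -> ~ In r ins).
  { intros r Hr H. specialize (Hins' r H). lia. }
  (* Between rounds, [b] holds the number of rounds left, [b + 1] the number done, and [b + 2] the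
     current value; [b + 3] receives the next value and is zero again after each round. *)
  set (st m n y := upd (upd (upd s b m) (b + 1) n) (b + 2) y).
  econstructor.
  { apply exec_copy; try lia. apply Hs; lia. }
  rewrite (Hs b) by lia. simpl plus.
  econstructor.
  { apply (Hf _ _ HY0); try lia; auto.
    - apply map_upd, Hout'. lia.
    - intros j Hj. specialize (Hins' j Hj). lia.
    - apply Hout'. lia.
    - intros r Hr. rewrite upd_other by lia. apply Hs. lia. }
  rewrite upd_other, (Hs (b + 2)) by lia. simpl plus.
  match goal with |- context [Loop b ?c] => set (body := c) end.
  enough (Hloop : forall m n, n + m = s i ->
    exec (Loop b body) (st m n (Y n)) (st 0 (s i) (Y (s i)))).
  { econstructor.
    - replace (upd _ _ _) with (st (s i) 0 (Y 0)); [apply (Hloop (s i) 0 eq_refl)|].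
      unfold st. upd_solve. now rewrite Hs by lia.
    - econstructor; [apply exec_move; lia|].
      eapply exec_eq; [apply exec_clear|].
      unfold st. upd_solve; rewrite ?Hs by lia; lia. }
  induction m as [|m IH]; intros n Hn.
  { rewrite Nat.add_0_r in Hn. subst n. constructor. unfold st. upd_cases. }
  eapply exec_loop_dec; [unfold st; upd_cases| |apply (IH (S n)); lia].
  replace (upd (st (S m) n (Y n)) b m) with (st m n (Y n)) by (unfold st; upd_solve).
  econstructor.
  { eapply (Hg _ _ (HY n ltac:(lia))); try lia.
    - simpl. f_equal; [|f_equal].
      + unfold st. upd_cases.
      + unfold st. upd_cases.
      + unfold st. rewrite !map_upd; auto; apply Hout'; lia.
    - intros j [<-|[<-|Hj]]; try lia. specialize (Hins' j Hj). lia.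
    - intros [H|[H|H]]; [lia|lia|]. revert H. apply Hout'. lia.
    - intros r Hr. unfold st. rewrite !upd_other by lia. apply Hs. lia. }
  econstructor; [apply exec_clear|]. econstructor; [apply exec_move; lia|].
  eapply exec_eq; [constructor|].
  unfold st. upd_solve; rewrite ?Hs by lia; lia.
Qed.

Lemma compile_RMu f : compiles f -> compiles (RMu f).
Proof.
  intros Hf xs N Hev ins out b s Hxs Hins Hout Hio Hs.
  inversion Hev as [| | | | | |? ? ? H0 Hpos]; subst. simpl.
  assert (Hfresh : forall r, b <= r -> ~ In r ins).
  { intros r Hr H. specialize (Hins r H). lia. }
  (* Register [b] holds the candidate and [b + 1] the value of [f] at it. This value is positive
     below [N], which keeps the loop going, and 0 at [N], which stops it. *)
  set (st n v := upd (upd s b n) (b + 1) v).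
  assert (Hcall : forall n v, ev f (n :: map s ins) v ->
    exec (compile f (b :: ins) (b + 1) (b + 2)) (st n 0) (st n v)).
  { intros n v Hv. eapply exec_eq.
    - apply (Hf _ _ Hv); try lia.
      + simpl. f_equal; unfold st; [upd_cases|].
        rewrite !map_upd; auto; apply Hfresh; lia.
      + intros j [<-|Hj]; [lia|]. specialize (Hins j Hj). lia.
      + intros [H|H]; [lia|]. revert H. apply Hfresh. lia.
      + intros r Hr. unfold st. rewrite !upd_other by lia. apply Hs. lia.
    - unfold st. upd_solve. }
  match goal with |- context [Loop (b + 1) ?c] => set (body := c) end.
  enough (Hloop : forall d n, n + d = N -> exists v, ev f (n :: map s ins) v /\
    exec (Loop (b + 1) body) (st n v) (st N 0)).
  { destruct (Hloop N 0 eq_refl) as (v & Hv & Hl).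
    econstructor.
    - replace s with (st 0 0); [exact (Hcall 0 v Hv)|].
      unfold st. upd_solve; now rewrite Hs by lia.
    - econstructor; [exact Hl|].
      eapply exec_eq; [apply exec_move; lia|].
      unfold st. upd_solve; rewrite ?Hs by lia; lia. }
  induction d as [|d IH]; intros n Hn.
  { rewrite Nat.add_0_r in Hn. subst n. exists 0; split; [exact H0|].
    constructor. unfold st. upd_cases. }
  destruct (Hpos n ltac:(lia)) as [k Hk]. exists (S k); split; [exact Hk|].
  destruct (IH (S n) ltac:(lia)) as (v & Hv & Hl).
  apply exec_loop_dec with (v := k) (t := st (S n) v);
    [unfold st; upd_cases| |exact Hl].
  econstructor; [apply exec_clear|]. econstructor; [constructor|].
  match goal with |- exec _ ?u _ => replace u with (st (S n) 0) end;
    [exact (Hcall (S n) v Hv)|].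
  unfold st. upd_solve.
Qed.

Theorem compile_correct f : compiles f.
Proof.
  induction f using recf_ind'; auto using compile_RComp, compile_RPrec, compile_RMu;
    intros xs y Hev ins out b s Hxs Hins Hout Hio Hs; inversion Hev; subst; simpl.
  - eapply exec_eq; [constructor|]. upd_solve.
  - destruct ins as [|j ins]; simpl in *; [discriminate|].
    econstructor.
    + specialize (Hins j (or_introl eq_refl)).
      apply exec_copy; auto; lia.
    + eapply exec_eq; [constructor|].
      match goal with H : x :: _ = _ |- _ => injection H as -> _ end. upd_solve.
  - destruct (nth_error ins i) as [j|] eqn:Hj.
    + assert (Hin : In j ins) by exact (nth_error_In _ _ Hj).
      rewrite (nth_error_nth (map s ins) i 0 (x := s j)).
      * specialize (Hins j Hin).
        apply exec_copy; auto; [now intros ->|lia|lia].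
      * rewrite nth_error_map, Hj. reflexivity.
    (* A projection beyond the arguments has the default value 0, and [Skip] adds nothing. *)
    + rewrite nth_overflow; [|rewrite length_map; now apply nth_error_None].
      eapply exec_eq; [constructor|]. upd_solve.
Qed.

(** * Computability of the self-referential sequent *)

Definition computes (f : recf) (F : nat -> nat) : Prop := forall x, ev f [x] (F x).

Definition rcompose (f g : recf) : recf := RComp f [g].

Lemma computes_compose f F g G :
  computes f F -> computes g G -> computes (rcompose f g) (fun x => F (G x)).
Proof. intros Hf Hg x. repeat econstructor; [apply Hg|apply Hf]. Qed.

Lemma computes_ext f F G : computes f F -> (forall x, F x = G x) -> computes f G.
Proof. intros Hf H x. rewrite <- H. apply Hf. Qed.

Definition rid : recf := RProj 0.

Lemma computes_id : computes rid (fun x => x).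
Proof. intros x. exact (ev_proj 0 [x]). Qed.

Lemma computes_succ : computes RSucc S.
Proof. intros x. constructor. Qed.

(** The step function receives the counter at position 0 and the previous value at position 1, hence
    [RProj 1]. *)
Definition riter (f g h : recf) : recf :=
  RComp (RPrec rid (RComp f [RProj 1])) [g; h].

Lemma computes_iter f F g G h H :
  computes f F -> computes g G -> computes h H ->
  computes (riter f g h) (fun x => Nat.iter (G x) F (H x)).
Proof.
  intros Hf Hg Hh x. econstructor; [econstructor; [apply Hg|econstructor; [apply Hh|constructor]]|].
  generalize (G x). intros n. induction n as [|n IH]; simpl.
  - constructor. apply computes_id.
  - econstructor; [exact IH|]. econstructor; [|apply Hf].
    econstructor; [|constructor]. exact (ev_proj 1 [n; _; H x]).
Qed.

Fixpoint rconst (k : nat) : recf :=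
  match k with
  | 0 => RZero
  | S k => rcompose RSucc (rconst k)
  end.

Lemma computes_const k : computes (rconst k) (fun _ => k).
Proof.
  induction k as [|k IH]; [intros x; constructor|].
  exact (computes_compose _ _ _ _ computes_succ IH).
Qed.

(** Here the step function returns the counter, which at [S n] is [n]. *)
Definition rpred : recf := RPrec RZero (RProj 0).

Lemma computes_pred : computes rpred Nat.pred.
Proof.
  intros n. induction n as [|n IH]; [repeat constructor|].
  apply (ev_precS _ _ _ _ _ _ IH). exact (ev_proj 0 [n; _]).
Qed.

Definition rdouble : recf := riter RSucc rid rid.

Lemma computes_double : computes rdouble (fun x => 2 * x).
Proof.
  eapply computes_ext.
  - exact (computes_iter _ _ _ _ _ _ computes_succ computes_id computes_id).
  - intros x. change (Nat.iter x S x = 2 * x).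
    enough (H : forall n m, Nat.iter n S m = n + m) by (rewrite H; lia).
    induction n as [|n IH]; intros m; simpl; [|rewrite <- IH]; reflexivity.
Qed.

Definition rpow2_mul (g h : recf) : recf := riter rdouble g h.

Lemma computes_pow2_mul g G h H :
  computes g G -> computes h H ->
  computes (rpow2_mul g h) (fun x => 2 ^ G x * H x).
Proof.
  intros Hg Hh. eapply computes_ext.
  - exact (computes_iter _ _ _ _ _ _ computes_double Hg Hh).
  - intros x. cbv beta. induction (G x) as [|n IH].
    + exact (eq_sym (Nat.mul_1_l _)).
    + rewrite Nat.pow_succ_r', <- Nat.mul_assoc, <- IH. reflexivity.
Qed.

(** By [S_npair] the successor of a pair is a power of 2 times an odd number, obtained by iterated
    doubling. It is also the code of a nonempty list. *)
Definition rcons (g h : recf) : recf :=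
  rpow2_mul g (rcompose RSucc (rcompose rdouble h)).

Lemma computes_cons g G h H :
  computes g G -> computes h H -> computes (rcons g h) (fun x => S (npair (G x) (H x))).
Proof.
  intros Hg Hh. eapply computes_ext.
  - exact (computes_pow2_mul _ _ _ _ Hg (computes_compose _ _ _ _ computes_succ
      (computes_compose _ _ _ _ computes_double Hh))).
  - intros x. simpl. rewrite S_npair. lia.
Qed.

Definition rpair (g h : recf) : recf := rcompose rpred (rcons g h).

Lemma computes_pair g G h H :
  computes g G -> computes h H -> computes (rpair g h) (fun x => npair (G x) (H x)).
Proof.
  intros Hg Hh.
  exact (computes_compose _ _ _ _ computes_pred (computes_cons _ _ _ _ Hg Hh)).
Qed.

(** The argument [q] is used twice: as the code of a tail and as the number of input units.
    Prepending a unit acts on list codes directly, so [q] is never decoded. *)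
Definition self_halting_code (q : nat) : nat :=
  npair
    (npair 0
       (S (npair (enc_tree (TF (Var (code Start))))
             (Nat.iter q (fun y => S (npair (enc_tree (TF (Var (code (inc 0))))) y)) q))))
    (enc_formula halting_goal).

Lemma self_halting_code_spec tail :
  self_halting_code (enc_list enc_tree tail) =
  enc_sequent ([], halting_seq (enc_list enc_tree tail) tail) halting_goal.
Proof.
  unfold self_halting_code, enc_sequent, enc_meta, halting_seq.
  cbn [fst snd enc_list]. do 4 f_equal.
  enough (forall n, Nat.iter n
    (fun y => S (npair (enc_tree (TF (Var (code (inc 0))))) y)) (enc_list enc_tree tail) =
    enc_list enc_tree (repeat (TF (Var (code (inc 0)))) n ++ tail)) as -> by reflexivity.
  induction n as [|n IH]; [reflexivity|].
  change (S (npair (enc_tree (TF (Var (code (inc 0)))))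
    (Nat.iter n (fun y => S (npair (enc_tree (TF (Var (code (inc 0))))) y))
      (enc_list enc_tree tail))) = enc_list enc_tree
    (TF (Var (code (inc 0))) :: repeat (TF (Var (code (inc 0)))) n ++ tail)).
  rewrite IH. reflexivity.
Qed.

Lemma self_halting_code_computable : exists f, computes f self_halting_code.
Proof.
  eexists.
  exact (computes_pair _ _ _ _
    (computes_pair _ _ _ _ (computes_const 0)
      (computes_cons _ _ _ _ (computes_const (enc_tree (TF (Var (code Start)))))
        (computes_iter _ _ _ _ _ _
          (computes_cons _ _ _ _
            (computes_const (enc_tree (TF (Var (code (inc 0)))))) computes_id)
          computes_id computes_id)))
    (computes_const (enc_formula halting_goal))).
Qed.

(** * The diagonal argument *)

Lemma DerivProblem_enc m C : DerivProblem (enc_sequent m C) <-> der m C.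
Proof.
  split; [|now exists m, C].
  intros (m' & C' & [-> ->]%enc_sequent_inj & H). exact H.
Qed.

Theorem theorem9 : ~ decidable_set DerivProblem.
Proof.
  intros [f Hf]. destruct self_halting_code_computable as [g Hg].
  (* Input in register 0, output in register 1, scratch space from register 2 on. *)
  set (c := compile (rcompose f g) [0] 1 2).
  set (q := enc_list enc_tree (program_tail c)).
  assert (Hc : forall y, ev f [self_halting_code q] y ->
    exec c (input q) (upd (input q) 1 y)).
  { intros y Hy. apply (compile_correct (rcompose f g) [q] y).
    - econstructor; [|exact Hy]. repeat econstructor. apply Hg.
    - reflexivity.
    - intros i [<-|[]]. lia.
    - lia.
    - now intros [|[]].
    - intros r Hr. apply upd_other. lia. }
  pose proof (Hf (self_halting_code q)) as [Hyes Hno].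
  (* If the sequent is derivable, [f] answers 1 and so [c] ends with output 1, whereas derivability
     yields a run with output 0; runs are deterministic. *)
  assert (Hn : ~ DerivProblem (self_halting_code q)).
  { intros H. pose proof (Hc 1 (Hyes H)) as He1.
    unfold q in H. rewrite self_halting_code_spec in H.
    apply DerivProblem_enc, derivable_halting in H as (t & He & Ht).
    rewrite <- (exec_det _ _ _ He1 _ He) in Ht. discriminate. }
  (* As the sequent is not derivable, [f] answers 0, so [c] halts with output 0, and this makes the
     sequent derivable. *)
  apply Hn. unfold q. rewrite self_halting_code_spec. apply DerivProblem_enc.
  apply (halting_derivable _ _ _ (Hc 0 (Hno Hn))). reflexivity.
Qed.
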